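(* For all integers $n,k\ge0$, $\sum_{\lambda\in\mathcal{T}_n^k}x^{w_{\mathcal{T}}^{\leftarrow}(\lambda)}=\widehat{\mathscr{B}}_n^k(x)$.
   Context: $\widehat{\mathscr{B}}_n^k(x)=\sum_{j=0}^{\min(n,k)} j!\,(x+1)(x+2)\cdots(x+j)\,S(n+1,j+1)\,S(k+1,j+1)$ with $S(\cdot,\cdot)$ the Stirling numbers of the second kind. For $n,k\ge1$, $\mathcal{T}_n^k$ is the set of alternative tableaux of rectangular shape $n\times k$: partial fillings of the cells of an $n\times k$ rectangle with left arrows $\leftarrow$ and down arrows $\downarrow$ such that every cell pointed to by an arrow (every cell strictly left of a $\leftarrow$ in its row, or strictly below a $\downarrow$ in its column) is empty. If $n=0$ or $k=0$, $\mathcal{T}_n^k$ consists of a single empty tableau. $w_{\mathcal{T}}^{\leftarrow}(\lambda)$ is the number of columns of $\lambda$ that contain a $\leftarrow$ but no $\downarrow$. *)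

(* Defs.v *)
From HB Require Import structures.
From mathcomp Require Import all_boot all_order all_algebra.

Set Implicit Arguments.
Unset Strict Implicit.
Unset Printing Implicit Defensive.

Import GRing.Theory.
Local Open Scope ring_scope.

Definition stirling2 (n k : nat) : nat :=
  #|[set P : {set {set 'I_n}} | partition P [set: 'I_n] & #|P| == k]|.

Definition poly_bernoulli_hat (n k : nat) : {poly int} :=
  \sum_(j < (minn n k).+1)
    (j`!)%:R * (\prod_(1 <= i < j.+1) ('X + i%:R))
    * (stirling2 n.+1 j.+1)%:R * (stirling2 k.+1 j.+1)%:R.

Inductive arrow : Type := LeftArrow | DownArrow.

Definition is_left (a : arrow) : bool := if a is LeftArrow then true else false.
Definition arrow_of_bool (b : bool) : arrow := if b then LeftArrow else DownArrow.

Lemma is_leftK : cancel is_left arrow_of_bool.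
Proof. by case. Qed.

HB.instance Definition _ := Equality.copy arrow (can_type is_leftK).
HB.instance Definition _ := Choice.copy arrow (can_type is_leftK).
HB.instance Definition _ := Countable.copy arrow (can_type is_leftK).
HB.instance Definition _ := Finite.copy arrow (can_type is_leftK).

(* A partial filling with n rows and k columns; [None] is an empty cell.
   Matrix conventions: row 0 is the top row, column 0 the leftmost column. *)
Definition filling (n k : nat) : Type := 'M[option arrow]_(n, k).

Definition points_to (n k : nat) (T : filling n k)
    (i : 'I_n) (j : 'I_k) (i' : 'I_n) (j' : 'I_k) : bool :=
  match T i j with
  | Some LeftArrow => (i' == i) && (j' < j)%N
  | Some DownArrow => (j' == j) && (i < i')%N
  | None => false
  end.

Definition is_alternative (n k : nat) (T : filling n k) : bool :=
  [forall i, forall j, forall i', forall j',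
     points_to T i j i' j' ==> (T i' j' == None)].

(* When n = 0 or k = 0 there is exactly one filling, and it is alternative, so
   this is the singleton of the empty tableau (whose weight below is 0). *)
Definition alternative_tableaux (n k : nat) : {set 'M[option arrow]_(n, k)} :=
  [set T | is_alternative T].

Definition left_weight (n k : nat) (T : filling n k) : nat :=
  #|[set j : 'I_k | [exists i, T i j == Some LeftArrow]
                    && ~~ [exists i, T i j == Some DownArrow]]|.

(* Main.v *)
Require Import Defs.
From mathcomp Require Import all_boot all_order all_algebra ring zify.

(** Build a tableau from right to left. Once the rightmost column is chosen, the
    rows where it has a left arrow must be empty everywhere else, and the other
    rows are unconstrained. Every down arrow of a column is its lowest nonempty
    cell, so a column is given by the set of its nonempty cells together with, when
    this set is nonempty, the direction of the lowest arrow. Hence the generating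
    function [f_k n] of [n * k] tableaux satisfies
    [f_k.+1 n = f_k n + \sum_(m < n) 'C(n, m) (x f_k m + f_k m.+1)],
    and the closed form satisfies the same recursion by Stirling identities. *)

Set Implicit Arguments.
Unset Strict Implicit.
Unset Printing Implicit Defensive.

Import GRing.Theory.
Local Open Scope ring_scope.

(** * Stirling numbers by recursion, and their binomial sums *)

Fixpoint stirling2_rec (n k : nat) : nat :=
  match n, k with
  | 0, 0 => 1
  | 0, _.+1 => 0
  | _.+1, 0 => 0
  | n'.+1, k'.+1 => k'.+1 * stirling2_rec n' k'.+1 + stirling2_rec n' k'
  end.

Arguments stirling2_rec : simpl never.

Lemma stirling2_recS (n k : nat) : stirling2_rec n.+1 k.+1
  = (k.+1 * stirling2_rec n k.+1 + stirling2_rec n k)%N.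
Proof. by []. Qed.

Lemma stirling2_rec_gt (n k : nat) : (n < k)%N -> stirling2_rec n k = 0%N.
Proof.
elim: n k => [|n IHn] [|k] //; rewrite ltnS => lt_nk.
by rewrite stirling2_recS !IHn ?muln0 // leqW.
Qed.

Lemma sum_subset_card (V : nmodType) (T : finType) (D : {set T})
    (f : nat -> V) :
  \sum_(A : {set T} | A \subset D) f #|A|
    = \sum_(m < #|D|.+1) f m *+ 'C(#|D|, m).
Proof.
rewrite (partition_big (fun A : {set T} => inord #|A| : 'I_#|D|.+1) predT) //=.
apply: eq_bigr => m _; rewrite -cards_draws -sumr_const.
have eqm (A : {set T}) : A \subset D -> (inord #|A| == m) = (#|A| == m).
  by move=> sAD; rewrite -val_eqE /= inordK // ltnS subset_leq_card.
rewrite (eq_bigl [pred A : {set T} | (A \subset D) && (#|A| == m)]); last first.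
  by move=> A /=; case: (boolP (A \subset D)) => //= /eqm.
by apply: eq_big => [A|A /andP[_ /eqP->]]; rewrite ?inE.
Qed.

(** Complementation form: [m] counts what remains of [D] once [A] is removed, be it the points
    outside a block or the rows outside a column's arrows. *)
Lemma sum_subset_cardC (V : nmodType) (T : finType) (D : {set T})
    (f : nat -> V) :
  \sum_(A : {set T} | A \subset D) f (#|D| - #|A|)%N
    = \sum_(m < #|D|.+1) f m *+ 'C(#|D|, m).
Proof.
rewrite (sum_subset_card D (fun m => f (#|D| - m)%N)).
rewrite (reindex_inj rev_ord_inj) /=; apply: eq_bigr => m _.
by rewrite subSS subKn ?bin_sub // -ltnS.
Qed.

Lemma sum_binS (V : nmodType) (n : nat) (f : nat -> V) :
  \sum_(m < n.+2) f m *+ 'C(n.+1, m)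
    = \sum_(m < n.+1) (f m + f m.+1) *+ 'C(n, m).
Proof.
rewrite big_ord_recl bin0 /=.
under eq_bigr => m _ do rewrite /bump /= add1n binS mulrnDr.
rewrite big_split /= big_ord_recr /= bin_small // mulr0n addr0 addrA.
under [RHS]eq_bigr => m _ do rewrite mulrnDl.
rewrite big_split /= [X in _ = X + _]big_ord_recl bin0.
by congr (_ + _ + _).
Qed.

(** Combinatorially, [m] is the number of points outside the block of a marked point. The proof uses
    only Pascal's rule and the recurrence, so that the identity can later serve to count
    partitions. *)
Lemma stirling2_rec_binomial (R : comNzRingType) (n k : nat) :
  \sum_(m < n.+1) (stirling2_rec m k)%:R *+ 'C(n, m)
    = (stirling2_rec n.+1 k.+1)%:R :> R.
Proof.
elim: n k => [|n IHn] k.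
  by rewrite big_ord1 bin0 mulr1n stirling2_recS muln0.
rewrite (sum_binS _ (fun m => (stirling2_rec m k)%:R)).
under eq_bigr => m _ do rewrite mulrnDl.
rewrite big_split /= IHn; case: k => [|k].
  rewrite [in RHS]stirling2_recS mul1n addn0.
  by rewrite big1 ?addr0 // => m _; rewrite mul0rn.
under eq_bigr => m _ do
  rewrite stirling2_recS natrD natrM mulrnDl -mulrnAr.
rewrite big_split /= -mulr_sumr !IHn [in RHS]stirling2_recS natrD natrM.
ring.
Qed.

(** Pascal's rule at [n.+1] splits the previous identity into the sum of the values at [m], which is
    known, and the sum at [m.+1], which is wanted; then the term [m = n] is removed. *)
Lemma stirling2_rec_binomial_lt (R : comNzRingType) (n k : nat) :
  \sum_(m < n) (stirling2_rec m.+1 k.+1)%:R *+ 'C(n, m)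
    = (k.+1 * stirling2_rec n.+1 k.+2)%:R :> R.
Proof.
have := sum_binS n (fun m => (stirling2_rec m k.+1)%:R : R).
rewrite stirling2_rec_binomial; under [RHS]eq_bigr => m _ do rewrite mulrnDl.
rewrite big_split /= stirling2_rec_binomial big_ord_recr /= binn mulr1n.
rewrite (stirling2_recS n.+1) natrD addrA => /addIr eq_sum.
rewrite -(addKr (stirling2_rec n.+1 k.+2)%:R (\sum_(_ < _) _)) -eq_sum !natrM.
ring.
Qed.

(* Exponential generating functions turn
   [f |-> \sum_(m < n) (x f m + f m.+1) 'C(n, m)] into
   [F |-> (e^z - 1) (x F + F')], acting on the basis [e^z (e^z - 1)^j / j!] of Stirling columns. *)
Lemma stirling2_rec_tableau_step (R : comNzRingType) (x : R) (n j : nat) :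
  \sum_(m < n) (x * (stirling2_rec m.+1 j.+1)%:R
                + (stirling2_rec m.+2 j.+1)%:R) *+ 'C(n, m)
    = (x + j.+1%:R) * j.+1%:R * (stirling2_rec n.+1 j.+2)%:R
      + j%:R * (stirling2_rec n.+1 j.+1)%:R :> R.
Proof.
under eq_bigr => m _ do
  rewrite (stirling2_recS m.+1) natrD natrM addrA -mulrDl mulrnDl -mulrnAr.
rewrite big_split /= -mulr_sumr stirling2_rec_binomial_lt natrM mulrA.
congr (_ + _); case: j => [|j].
  by rewrite mul0r big1 // => m _; rewrite mul0rn.
by rewrite stirling2_rec_binomial_lt natrM.
Qed.

(** * The tableau recursion for the closed form *)

Definition poly_bernoulli_hat_rec (n k : nat) : {poly int} :=
  \sum_(j < k.+1)
    (j`!)%:R * (\prod_(1 <= i < j.+1) ('X + i%:R))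
    * (stirling2_rec n.+1 j.+1)%:R * (stirling2_rec k.+1 j.+1)%:R.

Lemma poly_bernoulli_hat_rec_n0 (n : nat) : poly_bernoulli_hat_rec n 0 = 1.
Proof.
rewrite /poly_bernoulli_hat_rec big_ord1 /= big_nil.
have -> : stirling2_rec n.+1 1 = 1%N.
  by elim: n => // n IHn; rewrite stirling2_recS IHn.
by rewrite !mulr1.
Qed.

(** For fixed [k] the closed form is a linear combination of Stirling columns in [n], so the step
    identity applies term by term. The result matches the Stirling recurrence in [k] because
    [w j.+1 / w j] is the factor [('X + j.+1) * j.+1]. *)
Lemma poly_bernoulli_hat_recS (n k : nat) :
  poly_bernoulli_hat_rec n k.+1
    = poly_bernoulli_hat_rec n k
      + \sum_(m < n) ('X * poly_bernoulli_hat_rec m k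
                       + poly_bernoulli_hat_rec m.+1 k) *+ 'C(n, m).
Proof.
pose w (j : nat) : {poly int} := (j`!)%:R * \prod_(1 <= i < j.+1) ('X + i%:R).
have wS j : w j.+1 = w j * (('X + j.+1%:R) * j.+1%:R).
  by rewrite /w factS natrM big_nat_recr //=; ring.
pose S (i j : nat) : {poly int} := (stirling2_rec i.+1 j.+1)%:R.
have hatE i h :
  poly_bernoulli_hat_rec i h = \sum_(j < h.+1) w j * S i j * S h j by [].
have -> : \sum_(m < n) ('X * poly_bernoulli_hat_rec m k
                          + poly_bernoulli_hat_rec m.+1 k) *+ 'C(n, m)
    = \sum_(j < k.+1) w j * S k j *
        (('X + j.+1%:R) * j.+1%:R * S n j.+1 + j%:R * S n j).
  transitivity (\sum_(m < n) \sum_(j < k.+1)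
      w j * S k j * (('X * S m j + S m.+1 j) *+ 'C(n, m))).
    apply: eq_bigr => m _; rewrite !hatE mulr_sumr -big_split /= -sumrMnl.
    by apply: eq_bigr => j _; rewrite mulrnAr; congr (_ *+ _); ring.
  (* The sums can be exchanged since the range of [j] is bounded by [k] alone, not by the minimum of
     [m] and [k]. *)
  rewrite exchange_big /=; apply: eq_bigr => j _.
  by rewrite -mulr_sumr stirling2_rec_tableau_step.
rewrite !hatE -big_split /=.
transitivity (\sum_(j < k.+2) w j * S n j * (j.+1%:R * S k j)
   + \sum_(j < k.+1) w j.+1 * S n j.+1 * S k j).
  (* The second term of the recurrence for [S k.+1 j] vanishes at [j = 0]; shifting [j] turns the
     others into the second sum. *)
  rewrite [in RHS]big_ord_recl /= [LHS]big_ord_recl /= -addrA -big_split /=.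
  congr (_ + _); first by rewrite /S (stirling2_recS k.+1) addn0 natrM.
  apply: eq_bigr => j _; rewrite /bump /= add1n.
  by rewrite /S (stirling2_recS k.+1) natrD natrM; ring.
have Sk0 : S k k.+1 = 0 by rewrite /S stirling2_rec_gt.
rewrite big_ord_recr /= Sk0 !mulr0 addr0.
rewrite -big_split /=; apply: eq_bigr => j _.
by rewrite wS; ring.
Qed.

(** * Set partitions are counted by the Stirling recursion *)

Section Partitions.
Variable T : finType.
Implicit Types (D A : {set T}) (P : {set {set T}}).

Definition partitions_card D (k : nat) : {set {set {set T}}} :=
  [set P | partition P D & #|P| == k].

(** Adding the block [x |: A] is a bijection from the partitions of the remaining points; it is
    injective because no block of those contains [x]. *)
Lemma card_partitions_cover_block D A (x : T) (k : nat) :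
    x \notin D -> A \subset D ->
  #|[set P in partitions_card (x |: D) k.+1 | pblock P x :\ x == A]|
    = #|partitions_card (D :\: A) k|.
Proof.
move=> xD sAD; have xA : x \notin A by apply: contra xD; apply: (subsetP sAD).
have DE : (x |: D) :\: (x |: A) = D :\: A.
  apply/setP => y; rewrite !inE negb_or.
  by case: eqP => [->|//] /=; rewrite (negPf xD) andbF.
rewrite -[RHS](@card_in_imset _ _ (fun P => (x |: A) |: P)); last first.
  have notin P : P \in partitions_card (D :\: A) k -> x |: A \notin P.
    rewrite inE => /andP[pP _]; apply/negP => /(partitionS pP)/subsetP.
    by move/(_ x (setU11 _ _)); rewrite inE (negPf xD) andbF.
  move=> P Q /notin nP /notin nQ eqPQ.
  by rewrite -(setU1K nP) -(setU1K nQ) eqPQ.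
apply: eq_card => P; rewrite !inE; apply/andP/imsetP => [[/andP[pP cP] /eqP bE]|].
  have xc : x \in cover P by rewrite (cover_partition pP) setU11.
  have BE : pblock P x = x |: A by rewrite -bE setD1K // mem_pblock.
  have BP : x |: A \in P by rewrite -BE pblock_mem.
  exists (P :\ (x |: A)); last by rewrite setD1K.
  rewrite inE -DE partitionD1 //=.
  by move: cP; rewrite (cardsD1 (x |: A) P) BP add1n eqSS.
move=> [Q]; rewrite inE => /andP[pQ cQ] ->.
have pP : partition ((x |: A) |: Q) (x |: D).
  have -> : x |: D = (x |: A) :|: (D :\: A).
    apply/setP => y; rewrite !inE; case: eqP => //= _.
    by case: (boolP (y \in A)) => // /(subsetP sAD) ->.
  apply: partitionU1 => //.
    by apply/set0Pn; exists x; rewrite setU11.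
  rewrite -setI_eq0; apply/eqP/setP => y; rewrite !inE.
  by case: eqP => [->|_] /=; [rewrite (negPf xD) andbF | case: (y \in A)].
have BP : x |: A \in (x |: A) |: Q by rewrite setU11.
rewrite pP (def_pblock (partition_trivIset pP) BP (setU11 _ _)) setU1K // eqxx.
rewrite cardsU1 (eqP cQ); case: (boolP (_ \in Q)) => [/(partitionS pQ)/subsetP|_].
  by move/(_ x (setU11 _ _)); rewrite inE (negPf xD) andbF.
by rewrite add1n eqxx.
Qed.

Lemma card_partitions_card D (k : nat) :
  #|partitions_card D k| = stirling2_rec #|D| k.
Proof.
(* Strong induction on the cardinality: deleting the block of a point may remove many points at
   once. *)
elim: {D}_.+1 {-2}D (ltnSn #|D|) k => // n IHn D leDn k.
have [->|[x xD]] := set_0Vmem D.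
  rewrite cards0; have -> : partitions_card set0 k
      = [set P | (P == set0) && (k == 0%N)].
    apply/setP => P; rewrite !inE partition_set0.
    by case: eqP => [->|//] /=; rewrite cards0 eq_sym.
  case: k => [|k].
    rewrite -[RHS](cards1 (set0 : {set {set T}})).
    by apply: eq_card => P; rewrite !inE andbT.
  by apply: eq_card0 => P; rewrite !inE andbF.
rewrite -(setD1K xD); set E := D :\ x.
have xE : x \notin E by rewrite !inE eqxx.
have leEn : (#|E| < n)%N by move: leDn; rewrite (cardsD1 x D) xD.
rewrite cardsU1 xE add1n; case: k => [|k].
  apply: eq_card0 => P; rewrite !inE; apply/negP => /andP[pP /eqP/cards0_eq P0].
  move/cover_partition: pP; rewrite P0 /cover big_set0 => /setP/(_ x).
  by rewrite !inE eqxx.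
(* Partitions are sorted by the block of [x]; the count is cast to [int] because the binomial
   identity is stated in a ring. *)
apply/eqP; rewrite -(Num.Theory.eqr_nat int) -stirling2_rec_binomial.
rewrite -(sum_subset_cardC E (fun m => (stirling2_rec m k)%:R)).
rewrite -sum1_card natr_sum.
rewrite (partition_big (fun P => pblock P x :\ x) (fun A => A \subset E));
  last first.
  move=> P; rewrite inE => /andP[pP _]; rewrite -(setU1K xE) setSD //.
  by rewrite (partitionS pP) // pblock_mem // (cover_partition pP) setU11.
apply/eqP/eq_bigr => A sAE; rewrite -natr_sum; congr (_%:R).
rewrite -(cardsDS sAE) -IHn; last first.
  by apply: leq_ltn_trans leEn; rewrite subset_leq_card // subsetDl.
rewrite -(card_partitions_cover_block _ xE sAE) -sum1_card.
by apply: eq_bigl => P; rewrite !inE.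
Qed.

End Partitions.

Lemma stirling2E (n k : nat) : stirling2 n k = stirling2_rec n k.
Proof.
by have := card_partitions_card [set: 'I_n] k; rewrite cardsT card_ord.
Qed.

Lemma poly_bernoulli_hatE (n k : nat) :
  poly_bernoulli_hat n k = poly_bernoulli_hat_rec n k.
Proof.
pose F (j : nat) : {poly int} := (j`!)%:R * (\prod_(1 <= i < j.+1) ('X + i%:R))
    * (stirling2_rec n.+1 j.+1)%:R * (stirling2_rec k.+1 j.+1)%:R.
transitivity (\sum_(j < (minn n k).+1) F j).
  by apply: eq_bigr => j _; rewrite !stirling2E.
rewrite /poly_bernoulli_hat_rec (big_ord_widen_cond k.+1 xpredT F);
  last by rewrite ltnS geq_minr.
rewrite big_mkcond.
apply: eq_bigr => j _ /=; case: ltnP => // lt_j; rewrite /F.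
(* Beyond the minimum but at most [k], the index exceeds [n], which kills the factor in [n]. *)
have lt_nj : (n < j)%N by move: lt_j (ltn_ord j); lia.
by rewrite (@stirling2_rec_gt n.+1) ?mulr0 ?mul0r.
Qed.

Lemma ord1_ord0 (i : 'I_1) : i = ord0.
Proof. exact: ord1. Qed.

(** * Splitting off the rightmost column of a tableau *)

Section Tableaux.
Variable n : nat.
Implicit Types (k : nat) (R M : {set 'I_n}) (c : filling n 1).

Lemma is_alternativeP k (T : filling n k) :
  reflect
    ((forall i (j j' : 'I_k),
        T i j = Some LeftArrow -> (j' < j)%N -> T i j' = None)
     /\ (forall (i i' : 'I_n) j,
        T i j = Some DownArrow -> (i < i')%N -> T i' j = None))
    (is_alternative T).
Proof.
apply: (iffP idP) => [altT|[altL altD]].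
  have alt i j i' j' : points_to T i j i' j' -> T i' j' = None.
    move=> pt; apply/eqP; move: altT.
    move/forallP/(_ i)/forallP/(_ j)/forallP/(_ i')/forallP/(_ j')/implyP.
    by apply.
  split=> [i j j' Tij lt_j|i i' j Tij lt_i].
    by apply: (alt i j); rewrite /points_to Tij eqxx.
  by apply: (alt i j); rewrite /points_to Tij eqxx.
apply/forallP => i; apply/forallP => j; apply/forallP => i'; apply/forallP => j'.
apply/implyP; rewrite /points_to; case Tij: (T i j) => [[]|] // /andP[/eqP-> lt_].
  by rewrite (altL _ _ _ Tij).
by rewrite (altD _ _ _ Tij).
Qed.

(** Rows emptied by arrows further right are kept and excluded through [R], so the height stays [n]
    throughout the recursion. *)
Definition supported k (T : filling n k) R : bool :=
  [forall i, forall j, (T i j != None) ==> (i \in R)].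

Lemma supportedP k (T : filling n k) R :
  reflect (forall i j, T i j != None -> i \in R) (supported T R).
Proof.
apply: (iffP forallP) => [sT i j|sT i]; first exact/implyP/(forallP (sT i)).
by apply/forallP => j; apply/implyP/sT.
Qed.

Definition left_rows k (T : filling n k) : {set 'I_n} :=
  [set i | [exists j, T i j == Some LeftArrow]].

(** Arrows of [T] never point into the column [c] on its right, and [c] affects [T] only through its
    left arrows, each of which empties a whole row of [T]. *)
Lemma alternative_row_mx k (T : filling n k) c R :
  is_alternative (row_mx T c) && supported (row_mx T c) R
    = (is_alternative c && supported c R)
      && (is_alternative T && supported T (R :\: left_rows c)).
Proof.
apply/andP/andP => [[/is_alternativeP[aL aD] /supportedP sR]|].
  have Tl i j : T i j = row_mx T c i (lshift 1 j) by rewrite row_mxEl.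
  have cr i j : c i j = row_mx T c i (rshift k j) by rewrite row_mxEr.
  split; apply/andP; split.
  - apply/is_alternativeP; split=> [i j j'|i i' j]; first by rewrite !ord1.
    by rewrite !cr; apply: aD.
  - by apply/supportedP => i j; rewrite cr; apply: sR.
  - apply/is_alternativeP; split=> [i j j'|i i' j]; rewrite !Tl.
      by move=> Tij lt_j; apply: aL Tij _.
    exact: aD.
  apply/supportedP => i j Tij; rewrite !inE; apply/andP; split; last first.
    by apply: (sR _ (lshift 1 j)); rewrite -Tl.
  apply: contra Tij => /existsP[j' /eqP]; rewrite cr Tl => cij.
  by apply/eqP/(aL _ _ _ cij); rewrite /= ltn_addr.
case=> /andP[/is_alternativeP[cL cD] /supportedP sc].
case/andP=> /is_alternativeP[TL TD] /supportedP sT; split.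
  apply/is_alternativeP; split=> [i j j'|i i' j].
    case: (split_ordP j) => [a ->|a ->]; rewrite ?row_mxEl ?row_mxEr => Tia;
    case: (split_ordP j') => [b ->|b ->]; rewrite ?row_mxEl ?row_mxEr /= => lt_b.
    - exact: TL Tia lt_b.
    - by have := ltn_trans lt_b (ltn_ord a); rewrite ltnNge leq_addr.
    - apply/eqP; apply: contraT => /sT; rewrite !inE => /andP[/negP[]].
      by apply/existsP; exists a; rewrite Tia.
    - by move: lt_b; rewrite (ord1_ord0 a) (ord1_ord0 b) ltnn.
  case: (split_ordP j) => [a ->|a ->]; rewrite ?row_mxEl ?row_mxEr.
    exact: TD.
  exact: cD.
apply/supportedP => i j; case: (split_ordP j) => [a ->|a ->].
  by rewrite row_mxEl => /sT; rewrite inE => /andP[].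
by rewrite row_mxEr => /sc.
Qed.

Lemma left_weightE k (T : filling n k) :
  left_weight T
    = \sum_(j < k) ([exists i, T i j == Some LeftArrow]
                     && ~~ [exists i, T i j == Some DownArrow] : nat).
Proof.
rewrite /left_weight -sum1_card big_mkcond; apply: eq_bigr => j _.
by rewrite inE; case: ifP.
Qed.

Lemma left_weight_row_mx k (T : filling n k) c :
  left_weight (row_mx T c) = (left_weight T + left_weight c)%N.
Proof.
rewrite !left_weightE big_split_ord /=.
by congr (_ + _)%N; apply: eq_bigr => j _; congr (nat_of_bool (_ && ~~ _));
  apply: eq_existsb => i; rewrite ?row_mxEl ?row_mxEr.
Qed.

Definition tableau_sum k R : {poly int} :=
  \sum_(T : filling n k | is_alternative T && supported T R) 'X^(left_weight T).

Lemma tableau_sum_addn1 k R :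
  tableau_sum (k + 1) R
    = \sum_(c : filling n 1 | is_alternative c && supported c R)
        'X^(left_weight c) * tableau_sum k (R :\: left_rows c).
Proof.
rewrite /tableau_sum (reindex (fun p : filling n 1 * filling n k =>
  row_mx p.2 p.1 : filling n (k + 1))); last first.
  exists (fun T => (rsubmx T, lsubmx T)) => [[c T] _|T _] /=.
    by rewrite row_mxKl row_mxKr.
  by rewrite hsubmxK.
under [RHS]eq_bigr => c _ do rewrite mulr_sumr.
rewrite pair_big_dep /=; apply: eq_big => [[c T]|[c T] _] /=.
  exact: alternative_row_mx.
by rewrite left_weight_row_mx addnC exprD.
Qed.

(** * Classification of single columns *)

(** Rows are numbered downwards, so the lowest arrow sits at the largest index of this set. *)
Definition arrow_rows c : {set 'I_n} := [set i | c i ord0 != None].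

Definition arrow_column M (down : bool) : filling n 1 :=
  \col_i (if i \notin M then None
          else if down && [forall i' in M, i' <= i]%N then Some DownArrow
          else Some LeftArrow).

Lemma arrow_columnE M down i (j : 'I_1) :
  arrow_column M down i j
    = if i \notin M then None
      else if down && [forall i' in M, i' <= i]%N then Some DownArrow
      else Some LeftArrow.
Proof. by rewrite mxE. Qed.

Lemma supported_column c R : supported c R = (arrow_rows c \subset R).
Proof.
apply/supportedP/subsetP => [sc i|sc i j cij]; first by rewrite inE => /sc.
by apply: sc; rewrite inE -(ord1_ord0 j).
Qed.

Lemma alternative_columnE c M :
  is_alternative c && (arrow_rows c == M)
    = (c == arrow_column M false) || (c == arrow_column M true).
Proof.
apply/andP/orP => [[/is_alternativeP[_ cD] /eqP <-]|cE].
  have cE b : b = [exists i, c i ord0 == Some DownArrow] ->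
      c = arrow_column (arrow_rows c) b.
    move=> bE; apply/matrixP => i j; rewrite arrow_columnE (ord1_ord0 j) inE negbK.
    case: eqP => [//|]; case ci: (c i ord0) => [[]|] // _; last first.
      suff -> : b && [forall i' in arrow_rows c, i' <= i]%N by [].
      rewrite bE; apply/andP; split; first by apply/existsP; exists i; rewrite ci.
      apply/forall_inP => i'; rewrite inE; apply: contraNT; rewrite -ltnNge.
      by move=> /(cD _ _ _ ci) ->.
    (* A left arrow in the lowest nonempty row excludes a down arrow at any [i0]: that arrow would
       lie in the same cell or point to this one. *)
    case: andP => // -[]; rewrite bE => /existsP[i0 /eqP ci0] /forall_inP/(_ i0).
    rewrite inE ci0 => /(_ isT); rewrite leq_eqVlt => /orP[/eqP/val_inj ii0|].
      by move: ci0; rewrite ii0 ci.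
    by move=> /(cD _ _ _ ci0); rewrite ci.
  case: (boolP [exists i, c i ord0 == Some DownArrow]) => [|/negPf] /esym.
    by move/cE <-; right.
  by move/cE <-; left.
have {cE} [b ->] : exists b, c = arrow_column M b.
  by case: cE => /eqP->; [exists false|exists true].
split; last first.
  apply/eqP/setP => i; rewrite inE arrow_columnE.
  by case: (i \in M) => //=; case: ifP.
apply/is_alternativeP; split=> [i j j'|i i' j].
  by rewrite (ord1_ord0 j) (ord1_ord0 j') ltnn.
rewrite !arrow_columnE; case: ifP => // _.
case: andP => // -[_ /forall_inP maxi] _.
by rewrite ltnNge; apply: contraNeq; case: (boolP (i' \in M)) => // /maxi.
Qed.

Lemma left_rows_column c : left_rows c = [set i | c i ord0 == Some LeftArrow].
Proof.
apply/setP => i; rewrite !inE; apply/existsP/idP => [[j]|].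
  by rewrite (ord1_ord0 j).
by exists ord0.
Qed.

Lemma left_rows_arrow_column M : left_rows (arrow_column M false) = M.
Proof.
rewrite left_rows_column; apply/setP => i; rewrite inE arrow_columnE.
by case: (i \in M).
Qed.

Lemma down_arrow_columnP M : M != set0 ->
  exists2 i0, i0 \in M & forall i j,
    arrow_column M true i j
      = if i == i0 then Some DownArrow
        else if i \in M then Some LeftArrow else None.
Proof.
case/set0Pn => i iM; case: (@arg_maxnP _ i (mem M) val iM) => i0 i0M maxi0.
exists i0 => // {iM} i j; rewrite arrow_columnE /=.
case: eqP => [->|ne_ii0].
  rewrite [i0 \in M]i0M /=; case: forall_inP => // -[] i' iM; exact: maxi0.
case: (boolP (i \in M)) => //= iM; case: forall_inP => // /(_ i0 i0M) le0.
by case: ne_ii0; apply/val_inj/eqP; rewrite eqn_leq le0 andbT; apply: maxi0.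
Qed.

Lemma left_weight_arrow_column M :
  left_weight (arrow_column M false) = (M != set0).
Proof.
rewrite left_weightE big_ord1; congr nat_of_bool.
have -> : [exists i, arrow_column M false i ord0 == Some DownArrow] = false.
  by apply/negbTE/existsPn => i; rewrite arrow_columnE; case: (i \in M).
rewrite andbT; apply/existsP/set0Pn => -[i].
  by rewrite arrow_columnE; case: (boolP (i \in M)) => // iM; exists i.
by move=> iM; exists i; rewrite arrow_columnE iM.
Qed.

(** For nonempty [M], the column of left arrows has weight 1 and blocks all of [M]; the one ending
    in a down arrow has weight 0 and leaves its lowest row free, hence the successor. For empty [M]
    the two columns coincide. *)
Lemma sum_column_arrow_rows R M (f : nat -> {poly int}) : M \subset R ->
  \sum_(c : filling n 1
         | is_alternative c && supported c R && (arrow_rows c == M))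
     'X^(left_weight c) * f #|R :\: left_rows c|
    = if M == set0 then f #|R|
      else 'X * f (#|R| - #|M|)%N + f (#|R| - #|M|).+1.
Proof.
move=> sMR; rewrite (eq_bigl
  [pred c | (c == arrow_column M false) || (c == arrow_column M true)]);
  last first.
  move=> c; rewrite /= -alternative_columnE supported_column -!andbA.
  congr (_ && _).
  by case: eqP => [->|]; rewrite ?andbF // sMR.
case: eqP => [M0|/eqP M_neq0].
  have eq_c : arrow_column M true = arrow_column M false.
    by apply/matrixP => i j; rewrite !arrow_columnE M0 inE.
  rewrite eq_c (big_pred1 (arrow_column M false)) => [|c]; last by rewrite /= orbb.
  by rewrite left_weight_arrow_column left_rows_arrow_column M0 eqxx setD0 mul1r.
have [i0 i0M downE] := down_arrow_columnP M_neq0.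
have neq_c : arrow_column M true != arrow_column M false.
  apply/eqP => /matrixP/(_ i0 ord0); rewrite downE eqxx arrow_columnE.
  by rewrite i0M.
rewrite (bigD1 (arrow_column M false)) /=; last by rewrite eqxx.
rewrite (big_pred1 (arrow_column M true)) => [|c]; last first.
  by rewrite /= andb_orl andbN /= andb_idr // => /eqP->.
rewrite left_weight_arrow_column M_neq0 left_rows_arrow_column cardsDS //.
have -> : left_weight (arrow_column M true) = 0%N.
  rewrite left_weightE big_ord1; case: existsP => //= _.
  by case: existsP => // -[]; exists i0; rewrite downE eqxx.
have -> : left_rows (arrow_column M true) = M :\ i0.
  rewrite left_rows_column; apply/setP => i; rewrite !inE downE.
  by case: (i == i0); case: (i \in M).
rewrite mul1r expr1 cardsDS; last exact: subset_trans (subsetDl _ _) sMR.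
by rewrite -subSn ?subset_leq_card // (cardsD1 i0 M) i0M.
Qed.

Lemma sum_columns R (f : nat -> {poly int}) :
  \sum_(c : filling n 1 | is_alternative c && supported c R)
     'X^(left_weight c) * f #|R :\: left_rows c|
    = f #|R| + \sum_(m < #|R|) ('X * f m + f m.+1) *+ 'C(#|R|, m).
Proof.
rewrite (partition_big arrow_rows (fun M => M \subset R)) => [|c]; last first.
  by rewrite supported_column => /andP[].
(* Here [m] is the number of rows of [R] outside [M]; the top value [#|R|] is the empty column. *)
pose g m := if m == #|R| then f #|R| else 'X * f m + f m.+1.
transitivity (\sum_(M : {set 'I_n} | M \subset R) g (#|R| - #|M|)%N).
  apply: eq_bigr => M sMR; rewrite (sum_column_arrow_rows f sMR) /g.
  have := subset_leq_card sMR; rewrite -cards_eq0 => leMR.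
  by have -> : ((#|R| - #|M|)%N == #|R|) = (#|M| == 0%N) by lia.
rewrite sum_subset_cardC big_ord_recr /= binn mulr1n /g eqxx addrC.
by congr (_ + _); apply: eq_bigr => m _; rewrite ltn_eqF.
Qed.

(** The induction must quantify over [R], since each column changes the set of available rows. *)
Lemma tableau_sumE k R : tableau_sum k R = poly_bernoulli_hat_rec #|R| k.
Proof.
elim: k R => [|k IHk] R.
  rewrite poly_bernoulli_hat_rec_n0 /tableau_sum (big_pred1 (const_mx None)) => [|T].
    by rewrite left_weightE big_ord0.
  have -> : T = const_mx None by apply/matrixP => i [].
  rewrite /= eqxx; apply/andP; split; last by apply/supportedP => i [].
  by apply/is_alternativeP; split=> [i []|i i' []].
rewrite poly_bernoulli_hat_recS -addn1 tableau_sum_addn1.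
under eq_bigr => c _ do rewrite IHk.
exact: (sum_columns R (poly_bernoulli_hat_rec^~ k)).
Qed.

End Tableaux.

Theorem theorem3p1 (n k : nat) :
  \sum_(T in alternative_tableaux n k) 'X^(left_weight T)
    = poly_bernoulli_hat n k.
Proof.
(* With all rows available, the support condition is vacuous. *)
rewrite poly_bernoulli_hatE -[in RHS](card_ord n) -cardsT -tableau_sumE.
apply: eq_bigl => T; rewrite inE; case: is_alternative => //=.
by apply/esym/supportedP => i j; rewrite inE.
Qed.
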